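(* Let $n\ge 2$ be an integer and let $\nu\in\{1,2,\ldots,n-1\}$. Put $C_n(\nu)=\sum_{l=1}^{n-1}\cos\frac{2\pi\nu l}{n}\csc\frac{\pi l}{n}$ and $S_n=\sum_{l=1}^{n-1}\csc\frac{\pi l}{n}$. Then the following four identities hold: $$C_n(\nu)=S_n-2\sum_{l=1}^{\nu}\cot\frac{(2l-1)\pi}{2n},$$ $$C_n(\nu)=S_n-2\sum_{l=1}^{n-1}\sin^2\frac{\pi\nu l}{n}\cdot\csc\frac{\pi l}{n},$$ $$C_n(\nu)=-S_n+2\sum_{l=1}^{n-1}\cos^2\frac{\pi\nu l}{n}\cdot\csc\frac{\pi l}{n},$$ $$C_n(\nu)=S_n-\cot\frac{\pi}{2n}+\cot\frac{\pi(2\nu+1)}{2n}-2\sum_{l=1}^{n-1}\cot\frac{\pi l}{n}\cdot\sin\frac{\pi l\nu}{n}\cdot\sin\frac{\pi l(\nu+1)}{n}.$$ *)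

(* Defs.v *)
From mathcomp Require Import all_boot all_order all_algebra.
From mathcomp Require Import reals trigo.

Set Implicit Arguments.
Unset Strict Implicit.
Unset Printing Implicit Defensive.

Import Order.TTheory GRing.Theory Num.Theory.

Local Open Scope ring_scope.

(* Where sin x = 0, both functions take the value 0, since 0^-1 = 0. *)
Definition csc (R : realType) (x : R) : R := (sin x)^-1.

Definition cot (R : realType) (x : R) : R := cos x / sin x.

Definition C_sum (R : realType) (n nu : nat) : R :=
  \sum_(1 <= l < n)
    cos (2 * pi * nu%:R * l%:R / n%:R) * csc (pi * l%:R / n%:R).

Definition S_sum (R : realType) (n : nat) : R :=
  \sum_(1 <= l < n) csc (pi * l%:R / n%:R).

(* Main.v *)
(* Write a for pi l / n.  Identities two and three are the half-angle formulas
   for cos (2 nu a).  For the other two, the key sum is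
   sum_(0 < l < n) sin ((2 nu + 1) a) = cot ((2 nu + 1) pi / (2 n)),
   which telescopes after multiplication by 2 sin ((2 nu + 1) pi / (2 n)).
   The first identity follows by induction on nu, because
   cos (2 nu a) - cos (2 (nu + 1) a) = 2 sin ((2 nu + 1) a) sin a; the last one
   because 2 cot a sin (nu a) sin ((nu + 1) a) =
   csc a - cos (2 nu a) csc a - sin a + sin ((2 nu + 1) a). *)
Require Import Defs.
From mathcomp Require Import all_boot all_order all_algebra.
From mathcomp Require Import reals trigo.
From mathcomp Require Import ring lra.

Set Implicit Arguments.
Unset Strict Implicit.
Unset Printing Implicit Defensive.

Import Order.TTheory GRing.Theory Num.Theory.

Local Open Scope ring_scope.

Section CosecantSums.
Variable R : realType.
Implicit Types (x y a : R) (n nu l : nat).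

(** The angle lies strictly between 0 and pi. This makes it legitimate to cancel [sin a] for a = pi
    l / n and, with [q] = 2n, the sine used for telescoping. *)
Lemma sin_frac_pi_gt0 (p q : nat) : (0 < p < q)%N ->
  0 < sin (pi * p%:R / q%:R) :> R.
Proof.
case/andP=> p0 pq; have q0 : 0 < q%:R :> R by rewrite ltr0n (ltn_trans p0).
apply: sin_gt0_pi; apply/andP; split.
  by rewrite divr_gt0 // mulr_gt0 ?pi_gt0 // ltr0n.
by rewrite ltr_pdivrMr // ltr_pM2l ?pi_gt0 // ltr_nat.
Qed.

Lemma cosB_cosD x y : cos (x - y) - cos (x + y) = 2 * sin x * sin y.
Proof. by rewrite cosB cosD; ring. Qed.

(** Evaluates the upper end of the telescoping sum; each induction step adds a full period. *)
Lemma cos_odd_piB k x : cos ((2 * k%:R + 1) * pi - x) = - cos x.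
Proof.
elim: k => [|k IH].
  by rewrite mulr0 add0r mul1r cosB cospi sinpi; ring.
have -> : (2 * k.+1%:R + 1) * pi - x = (2 * k%:R + 1) * pi - x + pi + pi.
  by rewrite -natr1; ring.
by rewrite !cosDpi opprK.
Qed.

Lemma sum_sin_odd n nu : (nu < n)%N ->
  \sum_(1 <= l < n) sin ((2 * nu%:R + 1) * (pi * l%:R / n%:R)) =
  cot (pi * (2 * nu%:R + 1) / (2 * n%:R)) :> R.
Proof.
move=> nun; have n0 : (0 < n)%N by apply: leq_ltn_trans nun.
have nz : n%:R != 0 :> R by rewrite pnatr_eq0 -lt0n.
set y := pi * _ / (2 * _).
have sy : sin y != 0.
  rewrite gt_eqF //.
  have -> : y = pi * (2 * nu + 1)%:R / (2 * n)%:R by rewrite /y natrD !natrM.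
  by apply: sin_frac_pi_gt0; rewrite addn1 /= !mul2n ltn_Sdouble.
apply: (mulIf sy); rewrite /cot divfK // mulr_suml.
(* A discrete primitive: (2 nu + 1) a = 2 l y, and sin (2 l y) sin y is half of cos (2 l y - y) -
   cos (2 l y + y), that is, [f l.+1 - f l]. *)
pose f l : R := - cos (2 * l%:R * y - y) / 2.
rewrite (eq_bigr (fun l => f l.+1 - f l)) => [|l _]; last first.
  have -> : (2 * nu%:R + 1) * (pi * l%:R / n%:R) = 2 * l%:R * y.
    by rewrite /y; field.
  have := cosB_cosD (2 * l%:R * y) y.
  have -> : 2 * l%:R * y + y = 2 * l.+1%:R * y - y by rewrite -natr1; ring.
  by rewrite /f; lra.
rewrite telescope_sumr // /f.
(* The end values are f(n) = cos y / 2 and f(1) = - cos y / 2, so the sum telescopes to cos y. *)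
have -> : 2 * n%:R * y - y = (2 * nu%:R + 1) * pi - y by rewrite /y; field.
have -> : 2 * 1%:R * y - y = y by ring.
by rewrite cos_odd_piB; lra.
Qed.

Lemma C_sum0 n : C_sum R n 0 = S_sum R n.
Proof. by apply: eq_bigr => l _; rewrite mulr0 !mul0r cos0 mul1r. Qed.

Lemma C_sum_step n nu : (nu < n)%N ->
  C_sum R n nu.+1 =
  C_sum R n nu - 2 * cot (pi * (2 * nu%:R + 1) / (2 * n%:R)).
Proof.
move=> nun; rewrite -sum_sin_odd // mulr_sumr -sumrB.
apply: eq_big_nat => l hl; rewrite /csc.
have := sin_frac_pi_gt0 hl; set a := pi * l%:R / n%:R => sa.
have -> : 2 * pi * nu.+1%:R * l%:R / n%:R = (2 * nu%:R + 1) * a + a.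
  by rewrite /a -natr1; ring.
have -> : 2 * pi * nu%:R * l%:R / n%:R = (2 * nu%:R + 1) * a - a.
  by rewrite /a; ring.
apply: (mulIf (lt0r_neq0 sa)); rewrite mulrBl !divfK ?gt_eqF //.
by have := cosB_cosD ((2 * nu%:R + 1) * a) a; lra.
Qed.

Lemma C_sum_cot n nu : (nu < n)%N ->
  C_sum R n nu = S_sum R n
    - 2 * \sum_(1 <= l < nu.+1) cot ((2 * l%:R - 1) * pi / (2 * n%:R)).
Proof.
(* The induction starts at [nu = 0], where the cotangent sum is empty and every cosine equals 1. *)
elim: nu => [|nu IH] nun; first by rewrite big_geq // C_sum0 mulr0 subr0.
rewrite C_sum_step 1?ltnW // IH 1?ltnW // (big_nat_recr nu.+1) //=.
have -> : (2 * nu.+1%:R - 1) * pi = pi * (2 * nu%:R + 1) :> R.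
  by rewrite -natr1; ring.
by ring.
Qed.

Lemma C_sum_sin2 n nu :
  C_sum R n nu = S_sum R n
    - 2 * \sum_(1 <= l < n)
            sin (pi * nu%:R * l%:R / n%:R) ^+ 2 * csc (pi * l%:R / n%:R).
Proof.
rewrite mulr_sumr -sumrB; apply: eq_bigr => l _.
have -> : 2 * pi * nu%:R * l%:R / n%:R = (pi * nu%:R * l%:R / n%:R) *+ 2 :> R.
  by ring.
by rewrite cos_mulr2n cos2sin2; ring.
Qed.

Lemma C_sum_cos2 n nu :
  C_sum R n nu = - S_sum R n
    + 2 * \sum_(1 <= l < n)
            cos (pi * nu%:R * l%:R / n%:R) ^+ 2 * csc (pi * l%:R / n%:R).
Proof.
rewrite mulr_sumr -sumrN -big_split; apply: eq_bigr => l _ /=.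
have -> : 2 * pi * nu%:R * l%:R / n%:R = (pi * nu%:R * l%:R / n%:R) *+ 2 :> R.
  by ring.
by rewrite cos_mulr2n; ring.
Qed.

(** Conceptually, 2 sin x sin (x + a) = cos a - cos (2x + a); multiplying by cot a and expanding cos
    (2x) = cos ((2x + a) - a) gives the right-hand side. *)
Lemma cot_mul_sin_sin x a : sin a != 0 ->
  2 * (cot a * sin x * sin (x + a)) =
  csc a - cos (2 * x) * csc a - sin a + sin (2 * x + a).
Proof.
move=> sa; rewrite /cot /csc !sinD (mulr_natl x) cos_mulr2n sin_mulr2n.
apply: (mulIf sa); apply: subr0_eq.
have pyth y : 1 - cos y ^+ 2 - sin y ^+ 2 = 0 by rewrite sin2cos2 subrr.
(* The difference of the two sides, times [sin a], is written as an explicit combination of the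
   Pythagorean relations for a and x. *)
transitivity ((1 - cos a ^+ 2 - sin a ^+ 2) * (2 * cos x ^+ 2 - 2)
   + (1 - cos x ^+ 2 - sin x ^+ 2) * (- 2 * cos a ^+ 2)).
  by field.
by rewrite !pyth !mul0r addr0.
Qed.

Lemma C_sum_cot_sin_sin n nu : (nu < n)%N ->
  C_sum R n nu = S_sum R n
    - cot (pi / (2 * n%:R))
    + cot (pi * (2 * nu%:R + 1) / (2 * n%:R))
    - 2 * \sum_(1 <= l < n)
            cot (pi * l%:R / n%:R) * sin (pi * l%:R * nu%:R / n%:R)
              * sin (pi * l%:R * (nu%:R + 1) / n%:R).
Proof.
move=> nun; have n0 : (0 < n)%N by apply: leq_ltn_trans nun.
(* The key sum at [nu = 0] turns cot (pi / (2n)) into the sum of sin a. With the other cotangent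
   expanded likewise, the identity can be checked term by term. *)
have := sum_sin_odd n0; rewrite mulr0 add0r mulr1 => <-.
rewrite -(sum_sin_odd nun) mulr_sumr -sumrB -big_split -sumrB /=.
apply: eq_big_nat => l hl.
have := sin_frac_pi_gt0 hl; set a := pi * l%:R / n%:R => sa.
have -> : pi * l%:R * (nu%:R + 1) / n%:R = nu%:R * a + a by rewrite /a; ring.
have -> : pi * l%:R * nu%:R / n%:R = nu%:R * a by rewrite /a; ring.
have -> : 2 * pi * nu%:R * l%:R / n%:R = 2 * (nu%:R * a) by rewrite /a; ring.
have -> : (2 * nu%:R + 1) * a = 2 * (nu%:R * a) + a by ring.
by rewrite cot_mul_sin_sin ?gt_eqF // mul1r; ring.
Qed.

End CosecantSums.

Theorem theorem2 (R : realType) (n nu : nat)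
    (hn : (2 <= n)%N) (hnu : (1 <= nu <= n - 1)%N) :
  [/\ C_sum R n nu = S_sum R n
        - 2 * \sum_(1 <= l < nu.+1) cot ((2 * l%:R - 1) * pi / (2 * n%:R)),
      C_sum R n nu = S_sum R n
        - 2 * \sum_(1 <= l < n)
                sin (pi * nu%:R * l%:R / n%:R) ^+ 2 * csc (pi * l%:R / n%:R),
      C_sum R n nu = - S_sum R n
        + 2 * \sum_(1 <= l < n)
                cos (pi * nu%:R * l%:R / n%:R) ^+ 2 * csc (pi * l%:R / n%:R)
    & C_sum R n nu = S_sum R n
        - cot (pi / (2 * n%:R))
        + cot (pi * (2 * nu%:R + 1) / (2 * n%:R))
        - 2 * \sum_(1 <= l < n)
                cot (pi * l%:R / n%:R) * sin (pi * l%:R * nu%:R / n%:R)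
                  * sin (pi * l%:R * (nu%:R + 1) / n%:R)].
Proof.
have nun : (nu < n)%N.
  by case/andP: hnu => _; rewrite -ltnS subn1 prednK // ltnW.
split.
- exact: C_sum_cot.
- exact: C_sum_sin2.
- exact: C_sum_cos2.
- exact: C_sum_cot_sin_sin.
Qed.
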